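(* Let $S$ be a finite nonempty set. For each integer $k\ge 2$ we have $\mathcal L_k=\mathcal R^{cl}_k$ and $\mathcal R_k=\mathcal L^{cl}_k$.
   Context: $S^{\mathbb Z}$ carries the product topology; a cellular automaton (CA) is a continuous map $S^{\mathbb Z}\to S^{\mathbb Z}$ commuting with the shift $\sigma(x)_i=x_{i+1}$. A block rule is a function $\chi:S^n\to S^n$ ($n\ge1$). For $i\in\mathbb Z$, $\chi^i:S^{\mathbb Z}\to S^{\mathbb Z}$ applies $\chi$ at coordinate $i$: $\chi^i(x)_{[i,i+n)}=\chi(x_{[i,i+n)})$, and all other coordinates are unchanged. Define $\chi^{i+}(x)=\lim_{j\to\infty}\chi^{j}\circ\chi^{j-1}\circ\cdots\circ\chi^{i}(x)$ and, for a block rule $\xi$, $\xi^{i-}(x)=\lim_{j\to-\infty}\xi^{j}\circ\cdots\circ\xi^{i-2}\circ\xi^{i-1}(x)$; these limits always exist. If $\chi$ is bijective with inverse $\xi$, its (left-to-right) slider relation is the set of pairs $(y,z)\in S^{\mathbb Z}\times S^{\mathbb Z}$ such that for some $x\in S^{\mathbb Z}$ and $i\in\mathbb Z$, $\xi^{i-}(x)=y$ and $\chi^{i+}(x)=z$. A (left-to-right) slider is a function $f:S^{\mathbb Z}\to S^{\mathbb Z}$ whose graph is the slider relation of some bijective block rule (such $f$ is automatically a CA). A right-to-left slider is the mirror-image notion: $f$ is a right-to-left slider iff $\rho\circ f\circ\rho$ is a left-to-right slider, where $\rho(x)_i=x_{-i}$. Let $\mathcal R$ be the set of left-to-right sliders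 and $\mathcal L$ the set of right-to-left sliders on $S^{\mathbb Z}$. Let $\mathcal L_0=\mathcal R_0=\{\mathrm{id}\}$ and for $k\ge0$ let $\mathcal L_{k+1}=\mathcal L\circ\mathcal R_k$ and $\mathcal R_{k+1}=\mathcal R\circ\mathcal L_k$, where $X\circ Y=\{f\circ g: f\in X, g\in Y\}$. A CA $f$ is left-closing if $f(y)\ne f(y')$ for any distinct $y,y'$ with $y_{[i,\infty)}=y'_{[i,\infty)}$ for some $i$; it is right-closing if $f(y)\neq f(y')$ for any distinct $y,y'$ with $y_{(-\infty,i)}=y'_{(-\infty,i)}$ for some $i$. Let $\mathcal L^{cl}$ be the set of left-closing CA and $\mathcal R^{cl}$ the set of right-closing CA on $S^{\mathbb Z}$. Let $\mathcal L^{cl}_0=\mathcal R^{cl}_0=\{\mathrm{id}\}$ and for $k\ge0$ let $\mathcal L^{cl}_{k+1}=\mathcal L^{cl}\circ\mathcal R^{cl}_k$ and $\mathcal R^{cl}_{k+1}=\mathcal R^{cl}\circ\mathcal L^{cl}_k$. *)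

(* Defs.v *)
From HB Require Import structures.
From mathcomp Require Import all_boot all_order all_algebra.
From mathcomp Require Import all_classical all_reals all_analysis.

Set Implicit Arguments.
Unset Strict Implicit.
Unset Printing Implicit Defensive.

Import Order.TTheory GRing.Theory Num.Theory.

Local Open Scope classical_set_scope.
Local Open Scope ring_scope.

(* The underlying type is convertible to int -> S. *)
Definition config (S : finType) : topologicalType :=
  {ptws int -> discrete_topology S}.

Definition shift (S : finType) (x : config S) : config S :=
  fun i => x (i + 1).

Definition flip (S : finType) (x : config S) : config S :=
  fun i => x (- i).

Definition cellular_automaton (S : finType) (f : config S -> config S) : Prop :=
  continuous f /\ forall x, f (shift x) = shift (f x).

Definition block_rule (S : finType) (n : nat) := n.-tuple S -> n.-tuple S.

Definition window (S : finType) (n : nat) (x : config S) (i : int) : n.-tuple S :=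
  [tuple (x (i + (k : nat)%:Z) : S) | k < n].

(* The default value of nth is never reached: 0 <= j - i < n in that branch. *)
Definition block_at (S : finType) (n : nat) (chi : block_rule S n) (i : int)
    (x : config S) : config S :=
  fun j => if (i <= j) && (j < i + n%:Z)
           then nth (x j : S) (chi (window n x i)) (absz (j - i)) else x j.

(* chi^{i+m-1} o ... o chi^{i+1} o chi^i (m factors) *)
Fixpoint sweep_right (S : finType) (n : nat) (chi : block_rule S n) (i : int)
    (m : nat) (x : config S) : config S :=
  if m is m'.+1 then block_at chi (i + m'%:Z) (sweep_right chi i m' x) else x.

(* xi^{i-m} o ... o xi^{i-2} o xi^{i-1} (m factors) *)
Fixpoint sweep_left (S : finType) (n : nat) (xi : block_rule S n) (i : int)
    (m : nat) (x : config S) : config S :=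
  if m is m'.+1 then block_at xi (i - m'.+1%:Z) (sweep_left xi i m' x) else x.

(* The equations xi^{i-}(x) = y and chi^{i+}(x) = z are expressed as convergence
   of the partial sweeps; the space is Hausdorff, so limits are unique. *)
Definition slider_relation (S : finType) (n : nat) (chi xi : block_rule S n)
    (y z : config S) : Prop :=
  exists (x : config S) (i : int),
    ((fun m => sweep_left xi i m x) @ \oo --> y) /\
    ((fun m => sweep_right chi i m x) @ \oo --> z).

Definition lr_slider (S : finType) : set (config S -> config S) :=
  [set f | exists (n : nat) (chi xi : block_rule S n),
     [/\ (1 <= n)%N, cancel chi xi, cancel xi chi &
         forall y z, slider_relation chi xi y z <-> f y = z]].

Definition rl_slider (S : finType) : set (config S -> config S) :=
  [set f | lr_slider (@flip S \o f \o @flip S)].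

Definition left_closing (S : finType) (f : config S -> config S) : Prop :=
  forall y y' : config S, y <> y' ->
    (exists i : int, forall j : int, i <= j -> y j = y' j) -> f y <> f y'.

Definition right_closing (S : finType) (f : config S -> config S) : Prop :=
  forall y y' : config S, y <> y' ->
    (exists i : int, forall j : int, j < i -> y j = y' j) -> f y <> f y'.

Definition left_closing_CA (S : finType) : set (config S -> config S) :=
  [set f | cellular_automaton f /\ left_closing f].

Definition right_closing_CA (S : finType) : set (config S -> config S) :=
  [set f | cellular_automaton f /\ right_closing f].

(* X o Y o X o ... with k alternating factors, X being the outermost one *)
Fixpoint alternating (T : Type) (X Y : set (T -> T)) (k : nat) : set (T -> T) :=
  if k is k'.+1
  then [set f \o g | f in X & g in alternating Y X k']
  else [set id].

Definition L_ (S : finType) (k : nat) : set (config S -> config S) :=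
  alternating (@rl_slider S) (@lr_slider S) k.

Definition R_ (S : finType) (k : nat) : set (config S -> config S) :=
  alternating (@lr_slider S) (@rl_slider S) k.

Definition Lcl_ (S : finType) (k : nat) : set (config S -> config S) :=
  alternating (@left_closing_CA S) (@right_closing_CA S) k.

Definition Rcl_ (S : finType) (k : nat) : set (config S -> config S) :=
  alternating (@right_closing_CA S) (@left_closing_CA S) k.

Arguments L_ S k : clear implicits.
Arguments R_ S k : clear implicits.
Arguments Lcl_ S k : clear implicits.
Arguments Rcl_ S k : clear implicits.

(* Main.v *)
From Pilot Require Import Defs.
From mathcomp Require Import all_boot all_order all_algebra.
From mathcomp Require Import all_classical all_reals all_analysis.
From mathcomp Require Import zify.
(* mathcomp-analysis also defines a [shift], which would hide the one of Defs. *)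
Import Pilot.Defs.

(** A slider is a transducer: reading the input symbol [y (i + N)] in the state
    [q i] (the [N = n - 1] cells under way), the bijection [chi] writes [z i] and
    moves to the state [q (i + 1)].

    Sliders are left-closing.  Call two states equivalent if they produce the
    same outputs on all future inputs.  The size of the class cannot decrease
    along a transition, and [chi] being a bijection the sums of these sizes
    before and after a step coincide; so sizes are constant, and equivalent
    states with the same output have equivalent predecessors reached by the same
    input.  Right-asymptotic points with the same image have equivalent states
    far to the right, hence are equal.

    Conversely, after a large left shift a left-closing automaton [g] only looks
    to the right.  The stair [(g(y)_[i,i+L), y_[i+L,i+2L))] and [y_(i+2L)] then
    determine [g(y)_i] and the next stair, and vice versa since [g] is
    left-closing.  A stair is a function of the word [y_[i,i+2L)]; its fibres
    have the same size along transitions, so this reversible transducer lifts to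
    a bijection on words of length [2L + 1], that is, to a slider.

    Hence a left-closing automaton becomes a left-to-right slider when composed
    with a large left shift, and symmetrically; with at least two factors these
    shifts can be made to cancel. *)

Set Implicit Arguments.
Unset Strict Implicit.
Unset Printing Implicit Defensive.

Import Order.TTheory GRing.Theory Num.Theory.

Local Open Scope classical_set_scope.
Local Open Scope ring_scope.

(** * Configurations: topology and compactness *)

Definition agree (S : Type) (r : nat) (x y : int -> S) : Prop :=
  forall j : int, (absz j <= r)%N -> x j = y j.

Lemma config_cvgP (S : finType) (F : set_system (config S)) (y : config S) :
  Filter F -> F --> y <-> forall j, F [set x : config S | x j = y j].
Proof.
move=> FF; split=> [Fy j|Fy].
  have yV := @discrete_set1 (discrete_topology S) (y j).
  exact: Fy (@proj_continuous int (fun=> discrete_topology S) j y _ yV).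
apply/cvg_sup => j U [V [[W oW <-] Wy] WU].
by apply: filterS (Fy j) => x /= xj; apply: WU; rewrite /= xj.
Qed.

Lemma config_seq_cvgP (S : finType) (u : nat -> config S) (y : config S) :
  u @ \oo --> y <-> forall j, exists M, forall m, (M <= m)%N -> u m j = y j.
Proof.
rewrite config_cvgP; split=> uy j.
  by have [M _ uM] := uy j; exists M => m Mm; apply: uM.
by have [M uM] := uy j; exists M => // m /= Mm; apply: uM.
Qed.

(** The sets containing a cylinder around [y] form a filter converging to [y] at each coordinate,
    hence finer than [nbhs y]. Conversely a cylinder is a finite intersection of coordinate
    conditions, added two at a time. *)
Lemma nbhs_configP (S : finType) (y : config S) (U : set (config S)) :
  nbhs y U <-> exists r, forall x : config S, agree r y x -> U x.
Proof.
split=> [yU|[r rU]].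
  pose G := [set V : set (config S) |
    exists r, forall x : config S, agree r y x -> V x].
  have FG : Filter G.
    split=> [|V W [r rV] [r' rW]|V W VW [r rV]].
    - by exists 0%N.
    - exists (maxn r r') => x yx; split; [apply: rV | apply: rW] => j jr;
      by apply: yx; lia.
    - by exists r => x /rV /VW.
  suff : G `=>` nbhs y by apply.
  by apply/(config_cvgP _ FG) => j; exists (absz j) => x yx /=; rewrite yx.
have yj := (config_cvgP y (nbhs_filter y)).1 (@cvg_id _ (nbhs y)).
elim: r U rU => [|r IH] U rU.
  by apply: filterS (yj 0) => x /= x0; apply: rU => j j0; have -> : j = 0 by lia.
have H : nbhs y [set x : config S | x r.+1%:Z = y r.+1%:Z ->
    x (- r.+1%:Z) = y (- r.+1%:Z) -> U x].
  apply: IH => x yx /= h1 h2; apply: rU => j jr.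
  have [jr'|jr'] := leqP (absz j) r; first exact: yx.
  by have [->|->] : j = r.+1%:Z \/ j = - r.+1%:Z by lia.
have FF := nbhs_filter y.
apply: filterS (filterI H (filterI (yj r.+1%:Z) (yj (- r.+1%:Z)))).
by move=> x /= [h [h1 h2]]; apply: h.
Qed.

(** Tychonoff, in the form used for limits of counterexamples; several sequences are handled at once
    by taking a product alphabet. *)
Lemma config_seq_cluster (S : finType) (u : nat -> config S) :
  exists y : config S, forall r N, exists2 m, (N <= m)%N & agree r y (u m).
Proof.
have cS : compact [set: discrete_topology S].
  by apply: finite_compact; exact: finite_finset.
have := @tychonoff int (fun=> discrete_topology S) (fun=> setT) (fun=> cS).
move=> /(_ (u @ \oo) _) [|y [_ cy]].
  by exists 0%N.
exists y => r N.
have := cy [set x | exists2 m, (N <= m)%N & x = u m] [set x | agree r y x].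
case.
- by exists N => // m /= Nm; exists m.
- by apply/nbhs_configP; exists r.
by move=> x [[m Nm ->] yx]; exists m.
Qed.

Definition translate (S : finType) (c : int) (x : config S) : config S :=
  fun j => x (j + c).

Lemma translateD (S : finType) (a b : int) (x : config S) :
  translate a (translate b x) = translate (a + b) x.
Proof. by apply/funext => j; rewrite /translate addrA. Qed.

Lemma translate0 (S : finType) (x : config S) : translate 0 x = x.
Proof. by apply/funext => j; rewrite /translate addr0. Qed.

Lemma commute_translate (S : finType) (f : config S -> config S) :
  (forall x : config S, f (shift x) = shift (f x)) ->
  forall c (x : config S), f (translate c x) = translate c (f x).
Proof.
move=> fs.
have fp n x : f (translate n%:Z x) = translate n%:Z (f x).
  elim: n x => [|n IH] x; first by rewrite !translate0.
  have tS (z : config S) : translate n.+1%:Z z = shift (translate n%:Z z).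
    by apply/funext => j; rewrite /translate /shift; congr (z _); lia.
  by rewrite !tS fs IH.
case=> n x; first exact: fp.
have {2}-> : x = translate n.+1%:Z (translate (- n.+1%:Z) x).
  by rewrite translateD subrr translate0.
by rewrite NegzE fp translateD addNr translate0.
Qed.

(** Half of the Curtis-Hedlund-Lyndon theorem: counterexamples of growing radius would accumulate at
    a point where [f] is discontinuous. *)
Lemma CA_local (S : finType) (f : config S -> config S) :
  cellular_automaton f -> exists r, forall x x' : config S,
    agree r x x' -> f x 0 = f x' 0.
Proof.
move=> [fc _]; apply: contrapT => /forallNP nr.
have /choice[u uP] : forall r, exists p : config S * config S,
    agree r p.1 p.2 /\ f p.1 0 <> f p.2 0.
  move=> r; have := nr r => /existsNP[x /existsNP[x' /not_implyP[xx' nf]]].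
  by exists (x, x').
have [y yu] := config_seq_cluster (fun m => (u m).1).
have : nbhs y [set x | f x 0 = f y 0].
  apply: (fc y [set x : config S | x 0 = f y 0]).
  by apply/nbhs_configP; exists 0%N => x /= <-.
move=> /nbhs_configP [r ry]; have [m rm ym] := yu r r.
have [um nu] := uP m; apply: nu; rewrite !ry // => j jr.
by rewrite (ym _ jr); apply: um; lia.
Qed.

(** The radius may depend on [y], so that a proof by contradiction can work at a fixed point. *)
Lemma CA_of_local (S : finType) (f : config S -> config S) :
  (forall x : config S, f (shift x) = shift (f x)) ->
  (forall y : config S, exists r, forall x : config S,
    agree r y x -> f x 0 = f y 0) ->
  cellular_automaton f.
Proof.
move=> fs fl; split=> // y.
have FF : Filter (f @ nbhs y) by apply: fmap_filter; exact: nbhs_filter.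
apply: (config_cvgP (f y) FF).2 => j.
have [r ry] := fl (translate j y).
apply/(nbhs_configP y); exists (r + absz j)%N => x yx /=.
have E (z : config S) : f z j = f (translate j z) 0.
  by rewrite commute_translate // /translate add0r.
by rewrite !E ry // => i ir; apply: yx; lia.
Qed.

(** * Sliders as runs of a transducer *)

Lemma nth_window (S : finType) (n : nat) (x : config S) (i : int) s0 k :
  (k < n)%N -> nth s0 (window n x i) k = x (i + k%:Z).
Proof.
move=> kn; have -> : k = Ordinal kn by [].
by rewrite -tnth_nth tnth_mktuple.
Qed.

Lemma eq_window (S : finType) (n : nat) (x : config S) (i : int) s0
    (t : n.-tuple S) :
  (forall k, (k < n)%N -> x (i + k%:Z) = nth s0 t k) -> window n x i = t.
Proof.
move=> xt; apply: val_inj; apply: (@eq_from_nth _ s0); rewrite !size_tuple //.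
by move=> k kn; rewrite nth_window // xt.
Qed.

Lemma window_rcons (S : finType) (n : nat) (x : config S) (i : int) :
  window n.+1 x i = [tuple of rcons (window n x i) (x (i + n%:Z) : S)].
Proof.
apply: (@eq_window _ _ _ _ (x 0)) => k kn.
rewrite [RHS](nth_rcons _ (window n x i)) size_tuple.
case: ltngtP => kn'; [by rewrite nth_window | by lia | by rewrite kn'].
Qed.

Lemma window_cons (S : finType) (n : nat) (x : config S) (i : int) :
  window n.+1 x i = [tuple of (x i : S) :: window n x (i + 1)].
Proof.
apply: (@eq_window _ _ _ _ (x 0)) => -[_|k kn].
  by rewrite addr0.
rewrite -[RHS]/(nth (x 0 : S) (window n x (i + 1)) k).
by rewrite nth_window //; congr (x _); lia.
Qed.

Lemma block_at_out (S : finType) (n : nat) (chi : block_rule S n) (i : int)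
    (x : config S) (j : int) :
  ~~ ((i <= j) && (j < i + n%:Z)) -> block_at chi i x j = x j.
Proof. by rewrite /block_at => h; rewrite (negbTE h). Qed.

Lemma window_block_at (S : finType) (n : nat) (chi : block_rule S n) (i : int)
    (x : config S) :
  window n (block_at chi i x) i = chi (window n x i).
Proof.
apply: (@eq_window _ _ _ _ (x 0)) => k kn; rewrite /block_at ifT; last by lia.
have -> : absz (i + k%:Z - i)%R = k by lia.
by apply: set_nth_default; rewrite size_tuple.
Qed.

Lemma block_atP (S : finType) (n : nat) (chi : block_rule S n) (i : int)
    (x x' : config S) :
  (forall j, ~~ ((i <= j) && (j < i + n%:Z)) -> x' j = x j) ->
  window n x' i = chi (window n x i) -> block_at chi i x = x'.
Proof.
move=> out win; apply/funext => j; rewrite /block_at.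
case: ifPn => [ij|/out //]; rewrite -win nth_window; last by lia.
by congr (x' _); lia.
Qed.

Lemma block_atK (S : finType) (n : nat) (chi xi : block_rule S n) (i : int)
    (x : config S) :
  cancel chi xi -> block_at xi i (block_at chi i x) = x.
Proof.
move=> chiK; apply: block_atP => [j /block_at_out-> //|].
by rewrite window_block_at chiK.
Qed.

Definition run (S : finType) (N : nat) (chi : block_rule S N.+1)
    (q : int -> N.-tuple S) (y z : config S) : Prop :=
  forall i, chi [tuple of rcons (q i) (y (i + N%:Z) : S)] =
            [tuple of (z i : S) :: q (i + 1)].

Lemma slider_relation_run (S : finType) (N : nat) (chi xi : block_rule S N.+1)
    (y z : config S) :
  cancel chi xi -> cancel xi chi ->
  slider_relation chi xi y z <-> exists q, run chi q y z.
Proof.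
move=> chiK xiK; split=> [[x [i [/config_seq_cvgP cy /config_seq_cvgP cz]]]|[q qP]].
  (* [X k] is the configuration on which [chi] acts at [i + k]; the leftward sweep supplies the
     negative [k], since [xi] undoes [chi]. *)
  pose X (k : int) := if k is Posz m then sweep_right chi i m x
                      else sweep_left xi i (absz k) x.
  have XS k : block_at chi (i + k) (X k) = X (k + 1).
    case: k => [m|[|m]].
    - by have -> : Posz m + 1 = Posz m.+1 by lia.
    - by rewrite /= block_atK.
    - have -> : Negz m.+1 + 1 = Negz m by lia.
      by rewrite [X (Negz m.+1)]/= NegzE block_atK.
  (* Blocks placed at [i + k] or later never touch the cells to their left, which are therefore
     final. *)
  have Xz k j : j < i + k -> X k j = z j.
    move=> jk; have [M zM] := cz j.
    rewrite -(zM (maxn M (absz k))); last by lia.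
    have : exists m : nat, (maxn M (absz k))%:Z = k + m%:Z.
      by exists (absz ((maxn M (absz k))%:Z - k)); lia.
    move=> [m kE]; rewrite -[sweep_right _ _ _ _]/(X _%:Z) kE.
    elim: m {kE} => [|m IH]; first by rewrite addr0.
    have -> : k + m.+1%:Z = k + m%:Z + 1 by lia.
    by rewrite -XS block_at_out //; lia.
  have Xy k j : i + k + N%:Z <= j -> X k j = y j.
    move=> jk; have [M yM] := cy j.
    have XN m : X (- m%:Z) = sweep_left xi i m x by case: m.
    rewrite -(yM (maxn M (absz k))); last by lia.
    have : exists m : nat, - (maxn M (absz k))%:Z = k - m%:Z.
      by exists (absz ((maxn M (absz k))%:Z + k)); lia.
    move=> [m kE]; rewrite -XN kE.
    elim: m {kE} => [|m IH]; first by rewrite subr0.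
    rewrite IH; have -> : k - m%:Z = k - m.+1%:Z + 1 by lia.
    by rewrite -XS block_at_out //; lia.
  exists (fun k => window N (X (k - i)) k) => k.
  rewrite -(Xy (k - i)); last by lia.
  rewrite -window_rcons -(Xz (k - i + 1)); last by lia.
  have -> : k + 1 - i = k - i + 1 by lia.
  rewrite -window_cons -XS.
  have <- : k = i + (k - i) by lia.
  by rewrite window_block_at.
(* Conversely, glue the output left of [k], the state on the next [N] cells, and the input not yet
   read. *)
pose X (k : int) : config S := fun j => if j < k then z j
  else if j < k + N%:Z then nth (z 0 : S) (q k) (absz (j - k)%R) else y j.
have XN k : window N (X k) k = q k.
  apply: (@eq_window _ _ _ _ (z 0)) => m mN; rewrite /X ifF; last by lia.
  rewrite ifT; last by lia.
  by congr nth; lia.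
have XS k : block_at chi k (X k) = X (k + 1).
  apply: block_atP => [j jk|].
    have [j1|j1] : j < k \/ k + N%:Z < j by lia.
      by rewrite /X !ifT //; lia.
    by rewrite /X !ifF //; lia.
  rewrite [LHS]window_cons [in RHS]window_rcons !XN.
  have -> : X k (k + N%:Z) = y (k + N%:Z) by rewrite /X ifF ?ifF //; lia.
  by rewrite qP /X ifT //; lia.
have XR m : sweep_right chi 0 m (X 0) = X m%:Z.
  elim: m => //= m ->; rewrite add0r XS; congr X; lia.
have XL m : sweep_left xi 0 m (X 0) = X (- m%:Z).
  elim: m => //= m ->; have -> : - m%:Z = 0 - m.+1%:Z + 1 by lia.
  by rewrite -XS block_atK //; congr X; lia.
exists (X 0), 0; split; apply/config_seq_cvgP => j.
  exists (absz j + N)%N => m jm; rewrite XL /X ifF ?ifF //; lia.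
by exists (absz j).+1 => m jm; rewrite XR /X ifT //; lia.
Qed.

(** * Sliders are left-closing automata *)

(** By counting, reading [s] maps the class of a state onto the class of its successor, so [p'] has
    a preimage there. *)
Lemma reverse_deterministic (Q S : finType) (th : Q * S -> S * Q) (E : rel Q) :
  injective th -> equivalence_rel E ->
  (forall q p s, E q p ->
    (th (q, s)).1 = (th (p, s)).1 /\ E (th (q, s)).2 (th (p, s)).2) ->
  forall q s p', E (th (q, s)).2 p' ->
    exists2 p, E q p & th (p, s) = ((th (q, s)).1, p').
Proof.
move=> thI eqE thE.
pose cl q := [set p | E q p]%SET.
have Exx q : E q q by have [] := eqE q q q.
have sub q s : ((fun p => (th (p, s)).2) @: cl q \subset cl (th (q, s)).2)%SET.
  apply/fintype.subsetP => _ /imsetP[p + ->]; rewrite !inE => qp.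
  by have [] := thE q p s qp.
(* Related states write the same symbol on [s], so injectivity of [th] keeps their successors
   distinct. *)
have card_im q s : #|((fun p => (th (p, s)).2) @: cl q)%SET| = #|cl q|.
  apply: card_in_imset => p p'; rewrite !inE => /(thE _ _ s) [ep _] /(thE _ _ s) [ep' _].
  move=> e; have : th (p, s) = th (p', s).
    by rewrite (surjective_pairing (th (p, s))) -ep ep' e -surjective_pairing.
  by move=> /thI [].
have le (x : Q * S) : (#|cl x.1| <= #|cl (th x).2|)%N.
  by case: x => q s /=; rewrite -(card_im q s); exact: subset_leq_card.
have [ht thK htK] : bijective th.
  by apply: inj_card_bij => //; rewrite !card_prod mulnC.
have sums : (\sum_(x : Q * S) #|cl x.1| = \sum_(x : Q * S) #|cl (th x).2|)%N.
  transitivity (\sum_(x : S * Q) #|cl x.2|)%N; last first.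
    by rewrite (reindex th) //; exists ht => x _.
  rewrite -(pair_bigA _ (fun q (s : S) => #|cl q|)) exchange_big /=.
  by rewrite (pair_bigA _ (fun (s : S) q => #|cl q|)).
(* A termwise inequality between equal sums is an equality in each term. *)
have cardE x : #|cl x.1| = #|cl (th x).2|.
  have h : (forall x : Q * S, true ->
      (#|cl x.1| <= #|cl (th x).2| ?= iff (#|cl x.1| == #|cl (th x).2|))%N).
    by move=> x' _; split.
  have [_] := leqif_sum h.
  by rewrite sums eqxx => /esym /forallP /(_ x) /eqP.
move=> q s p' qp'.
have : p' \in ((fun p => (th (p, s)).2) @: cl q)%SET.
  have /eqP -> : ((fun p => (th (p, s)).2) @: cl q)%SET == cl (th (q, s)).2.
    by rewrite eqEcard sub card_im (cardE (q, s)) leqnn.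
  by rewrite inE.
move=> /imsetP[p]; rewrite inE => qp ->; exists p => //.
by have [-> _] := thE q p s qp; rewrite -surjective_pairing.
Qed.

Section Transducer.
Variables (Q S : finType) (th : Q * S -> S * Q).

Fixpoint state (q : Q) (s : nat -> S) (m : nat) : Q :=
  if m is m'.+1 then (th (state q s m', s m')).2 else q.

Definition output (q : Q) (s : nat -> S) (m : nat) : S :=
  (th (state q s m, s m)).1.

Definition trun (d : int) (q : int -> Q) (y z : config S) : Prop :=
  forall i, th (q i, y (i + d)) = (z i : S, q (i + 1)).

(** The Nerode equivalence of the transducer, made boolean so that its classes can be counted. *)
Definition same_output (q p : Q) : bool :=
  `[< forall s m, output q s m = output p s m >].

Lemma same_output_equiv : equivalence_rel same_output.
Proof.
move=> q p r; split=> [|/asboolP qp]; first by apply/asboolP.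
by apply/asboolP/asboolP => h s m; rewrite -?h ?qp // -qp h.
Qed.

Lemma same_output_step q p s : same_output q p ->
  (th (q, s)).1 = (th (p, s)).1 /\ same_output (th (q, s)).2 (th (p, s)).2.
Proof.
move=> /asboolP qp; split; first exact: (qp (fun=> s) 0%N).
apply/asboolP => t m; pose st n := if n is n'.+1 then t n' else s.
have stE r n : state (th (r, s)).2 t n = state r st n.+1.
  by elim: n => //= n ->.
by have := qp st m.+1; rewrite /output !stE.
Qed.

Variables (f : config S -> config S) (d : int).
Hypothesis thI : injective th.
Hypothesis fP : forall y z, (exists q, trun d q y z) <-> f y = z.

Lemma trun_shift (y : config S) : f (shift y) = shift (f y).
Proof.
have [q qP] := (fP y (f y)).2 erefl.
apply/fP; exists (fun i => q (i + 1)) => i.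
by rewrite /shift -(qP (i + 1)); congr (th (_, y _)); lia.
Qed.

(** A limit of runs is a run. If inputs converging to [y] had outputs differing from [f y] at 0, a
    cluster point of their runs would be a run on [y] with a wrong output. *)
Lemma trun_CA : cellular_automaton f.
Proof.
apply: CA_of_local => [x|y]; first exact: trun_shift.
apply: contrapT => /forallNP nr.
have /choice[x xP] : forall r, exists x : config S,
    agree r y x /\ f x 0 <> f y 0.
  by move=> r; have /existsNP[x /not_implyP[yx nf]] := nr r; exists x.
have /choice[q qP] : forall r, exists q, trun d q (x r) (f (x r)).
  by move=> r; apply/fP.
pose u r : config (Q * S * S)%type := fun i => (q r i, x r i : S, f (x r) i : S).
have [a au] := config_seq_cluster u.
have ya j : (a j).1.2 = y j.
  have [m jm aum] := au (absz j) (absz j).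
  by rewrite aum //= (xP m).1 //.
have fa : f y = (fun j => (a j).2).
  apply/fP; exists (fun i => (a i).1.1) => i; rewrite -ya.
  have [m _ aum] := au (absz i + absz d + 1)%N 0%N.
  by rewrite !aum /=; [exact: qP | lia..].
have [m _ aum] := au 0%N 0%N.
by apply: (xP m).2; rewrite fa aum.
Qed.

(** Replace the input from [i + d] on by an arbitrary [s]. Each run, kept left of [i] and continued
    from its state there, is a run on the new input, and by locality of [f] both give the same
    outputs from [i] on. *)
Lemma trun_future (r : nat) (q q' : int -> Q) (y y' : config S) (k : int) :
  (forall x x' : config S, agree r x x' -> f x 0 = f x' 0) ->
  trun d q y (f y) -> trun d q' y' (f y') ->
  (forall j, k <= j -> y j = y' j) ->
  forall i, k + r%:Z <= i -> k <= i + d -> same_output (q i) (q' i).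
Proof.
move=> floc qP qP' yy' i ki kid; apply/asboolP => s m.
pose ext (q : int -> Q) (y : config S) : config S :=
  fun j => if j < i + d then y j else s (absz (j - (i + d))%R).
have extP p x (pP : trun d p x (f x)) n :
    f (ext p x) (i + n%:Z) = output (p i) s n.
  have -> : f (ext p x) =
      (fun j => if j < i then f x j else output (p i) s (absz (j - i)%R)).
    apply/fP; exists (fun j => if j < i then p j
                       else state (p i) s (absz (j - i)%R)) => j.
    rewrite /ext; have [ji|ji] := ltP j i.
      rewrite ifT; last by lia.
      rewrite pP; congr pair; case: ifPn => // ji'.
      have -> : j + 1 = i by lia.
      by rewrite subrr.
    rewrite !ifF; try lia.
    have -> : absz (j + d - (i + d))%R = absz (j - i)%R by lia.
    have -> : absz (j + 1 - i)%R = (absz (j - i)%R).+1 by lia.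
    by rewrite /= -surjective_pairing.
  by rewrite ifF; [congr output; lia|lia].
rewrite -(extP q y qP) -(extP q' y' qP').
have E (z : config S) j : f z j = f (translate j z) 0.
  by rewrite (commute_translate trun_shift) /translate add0r.
rewrite [LHS]E [RHS]E; apply: floc => j jr; rewrite /translate /ext.
by case: ifPn => // _; apply: yy'; lia.
Qed.

Lemma trun_left_closing : left_closing f.
Proof.
move=> y y' yn [k yy'] ff; apply: yn.
have [r floc] := CA_local trun_CA.
have [q qP] := (fP y (f y)).2 erefl.
have [q' qP'] := (fP y' (f y')).2 erefl.
pose i0 := k + r%:Z + (absz d)%:Z.
(* [reverse_deterministic] gives a state equivalent to [q i] from which reading [y (i + d)] leads to
   [q' (i + 1)] with the common output; injectivity of [th] identifies it with [q' i]. *)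
have step i : same_output (q (i + 1)) (q' (i + 1)) ->
    same_output (q i) (q' i) /\ y (i + d) = y' (i + d).
  move=> qq'; have := reverse_deterministic thI same_output_equiv same_output_step.
  move=> /(_ (q i) (y (i + d)) (q' (i + 1))); rewrite qP => /(_ qq').
  by move=> [p qp]; rewrite ff -qP' => /thI [<- <-].
have all m : same_output (q (i0 - m%:Z)) (q' (i0 - m%:Z)).
  elim: m => [|m IH].
    by rewrite subr0; apply: trun_future floc qP qP' yy' _ _ _; lia.
  by apply: (step _ _).1; have -> : i0 - m.+1%:Z + 1 = i0 - m%:Z by lia.
apply/funext => j; have [/yy' //|jk] := leP k j.
have := all (absz (i0 - (j - d + 1))%R).
have -> : i0 - (absz (i0 - (j - d + 1))%R)%:Z = j - d + 1 by lia.
by move=> /step[_]; rewrite subrK.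
Qed.

End Transducer.

Definition block_transducer (S : finType) (N : nat) (chi : block_rule S N.+1)
    (x : N.-tuple S * S) : S * N.-tuple S :=
  let t := chi [tuple of rcons x.1 x.2] in (thead t, [tuple of behead t]).

Lemma block_transducerE (S : finType) (N : nat) (chi : block_rule S N.+1)
    (q q' : N.-tuple S) (s o : S) :
  block_transducer chi (q, s) = (o, q') <->
  chi [tuple of rcons q s] = [tuple of o :: q'].
Proof.
rewrite /block_transducer /=; split=> [[<- <-]|->]; first exact: tuple_eta.
by rewrite theadE; congr pair; apply: val_inj.
Qed.

Lemma rcons_tuple_inj (S : finType) (N : nat) (q p : N.-tuple S) (s t : S) :
  [tuple of rcons q s] = [tuple of rcons p t] -> (q, s) = (p, t).
Proof.
move=> /(congr1 val) /= /eqP; rewrite eqseq_rcons => /andP[/eqP qp /eqP ->].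
by congr pair; apply: val_inj.
Qed.

Lemma slider_left_closing (S : finType) (f : config S -> config S) :
  lr_slider f -> left_closing_CA f.
Proof.
move=> [[|N] [chi [xi [n0 chiK xiK fP]]]] //.
have thI : injective (block_transducer chi).
  move=> [q s] [p t]; case E : (block_transducer chi (p, t)) => [a q'].
  move=> /block_transducerE eq; move/block_transducerE : E; rewrite -eq.
  by move=> /(can_inj chiK) /rcons_tuple_inj.
have fT y z : (exists q, trun (block_transducer chi) N%:Z q y z) <-> f y = z.
  rewrite -fP slider_relation_run //.
  by split=> -[q qP]; exists q => i; apply/block_transducerE.
by split; [exact: trun_CA fT | exact: trun_left_closing thI fT].
Qed.

(** * Lifting a reversible quotient transducer *)

Section FibreLift.
Variables (W S V : finType) (pi : W -> V).
Variables (slide : W -> S -> W) (out hd : W -> S -> S).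
Hypothesis slideI : forall w s w' s',
  hd w s = hd w' s' -> slide w s = slide w' s' -> w = w' /\ s = s'.
Hypothesis fwd : forall w w' s, pi w = pi w' ->
  out w s = out w' s /\ pi (slide w s) = pi (slide w' s).
Hypothesis bwd : forall w w' s s', pi (slide w s) = pi (slide w' s') ->
  out w s = out w' s' -> pi w = pi w' /\ s = s'.

Let fib (v : V) : {set W} := [set w | pi w == v]%SET.

(** The dropped symbol [hd] and the new word determine [(w, s)]; hence each word arises by [slide]
    from exactly [#|S|] pairs. *)
Lemma sum_slide (F : W -> nat) :
  (\sum_(x : W * S) F (slide x.1 x.2) = #|S| * \sum_w F w)%N.
Proof.
pose h (x : W * S) := (hd x.1 x.2, slide x.1 x.2).
have [k hK kK] : bijective h.
  apply: inj_card_bij => [[w s] [w' s'] [e1 e2]|]; last by rewrite !card_prod mulnC.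
  by have [-> ->] := slideI e1 e2.
transitivity (\sum_(x : S * W) F x.2)%N.
  by rewrite [RHS](reindex h) //; exists k => x _.
by rewrite -(pair_bigA _ (fun (a : S) w => F w)) sum_nat_const.
Qed.

(* Along transitions the fibre cardinal is harmonic; as the transition graph
   has equal in- and out-degrees, the sum over the edges of the squared
   differences vanishes. *)
Lemma card_fibre_slide w s : #|fib (pi w)| = #|fib (pi (slide w s))|.
Proof.
(* The vertices are restricted to the image of [pi], so that each has a representative word
   [rho u]. *)
pose U := {v : V | v \in codom pi}.
pose p w : U := exist _ (pi w) (codom_f pi w).
pose rho (u : U) : W := iinv (valP u).
have rhoK u : p (rho u) = u by apply: val_inj; rewrite /= f_iinv.
have pE w1 w2 : pi w1 = pi w2 -> p w1 = p w2 by move=> e; apply: val_inj.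
have Ep w1 w2 : p w1 = p w2 -> pi w1 = pi w2 by move=> /(congr1 val).
pose c u := #|[set w | p w == u]%SET|.
have cE w1 : #|fib (pi w1)| = c (p w1).
  by apply: eq_card => w2; rewrite !inE -val_eqE.
pose t (x : U * S) : S * U := (out (rho x.1) x.2, p (slide (rho x.1) x.2)).
have tE w1 s1 : t (p w1, s1) = (out w1 s1, p (slide w1 s1)).
  have /Ep e := rhoK (p w1); have [e1 e2] := fwd s1 e.
  by congr pair => //; apply: pE.
clearbody t.
have [k tK kK] : bijective t.
  apply: inj_card_bij; last by rewrite !card_prod mulnC.
  move=> [u a] [u' a']; rewrite -(rhoK u) -(rhoK u') !tE => -[e1 e2].
  by have [/pE -> ->] := bwd e2 e1.
(* By [sum_slide], [#|S| * c u'] pairs slide into the fibre of [u']; grouped by the edge [(u, a)]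
   below them, each edge accounts for [c u] pairs. *)
have harm u' : (\sum_(x : U * S | (t x).2 == u') c x.1 = #|S| * c u')%N.
  rewrite /c -sum1_card (big_mkcond (fun w => w \in _)) -sum_slide.
  rewrite -big_mkcond /= (partition_big (fun x => (p x.1, x.2))
    (fun x => (t x).2 == u')) /=; last first.
    by move=> [w1 s1]; rewrite inE tE.
  apply: eq_bigr => -[u a] /= /eqP tu; rewrite -sum1_card.
  rewrite [RHS](reindex_onto (fun w1 => (w1, a)) fst) /=; last first.
    by move=> [w1 s1] /andP[_ /eqP[_ ->]].
  apply: eq_bigl => w1; rewrite !inE eqxx andbT xpair_eqE eqxx andbT.
  have [e|] := eqVneq (p w1) u; last by rewrite andbF.
  by rewrite andbT; move: tu; rewrite -e tE /= => ->; rewrite eqxx.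
(* The vanishing sum of squared differences, stated without subtraction. Both sums of squares equal
   [A], the second by reindexing along [t]; the cross term equals [A] by [harm]. *)
have sq : (\sum_(x : U * S) 2 * (c x.1 * c (t x).2) =
           \sum_(x : U * S) (c x.1 ^ 2 + c (t x).2 ^ 2))%N.
  pose A := (#|S| * \sum_u c u ^ 2)%N.
  transitivity (2 * \sum_(x : U * S) c x.1 * c (t x).2)%N.
    by rewrite big_distrr.
  rewrite big_split /=.
  have -> : (\sum_(x : U * S) c x.1 ^ 2 = A)%N.
    rewrite -(pair_bigA _ (fun u (a : S) => c u ^ 2)%N) /A big_distrr /=.
    by apply: eq_bigr => u _; rewrite sum_nat_const.
  have -> : (\sum_(x : U * S) c (t x).2 ^ 2 = A)%N.
    transitivity (\sum_(x : S * U) c x.2 ^ 2)%N.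
      by rewrite [RHS](reindex t) //; exists k => x _.
    by rewrite -(pair_bigA _ (fun (a : S) u => c u ^ 2)%N) sum_nat_const.
  have -> : (\sum_(x : U * S) c x.1 * c (t x).2 = A)%N; last by rewrite mul2n addnn.
  rewrite (partition_big (fun x => (t x).2) predT) //= /A big_distrr /=.
  apply: eq_bigr => u _; rewrite -mulnn mulnA -harm big_distrl /=.
  by apply: eq_bigr => x /eqP ->.
have h (x : U * S) : true -> (2 * (c x.1 * c (t x).2) <= c x.1 ^ 2 + c (t x).2 ^ 2
    ?= iff (c x.1 == c (t x).2))%N by move=> _; apply: nat_Cauchy.
have [_] := leqif_sum h.
rewrite sq eqxx => /esym /forallP /(_ (p w, s)) /eqP.
by rewrite tE !cE.
Qed.

(** [th] sends [w] to the word of the same rank in the fibre over [pi (slide w s)], which has the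
    same size. The words [base w] of rank 0 are preserved, and they will provide runs on every
    input. *)
Lemma fibre_lift : exists (th : W * S -> S * W) (base : W -> W),
  [/\ injective th,
      forall w s, (th (w, s)).1 = out w s /\ pi (th (w, s)).2 = pi (slide w s) &
      forall w s, th (base w, s) = (out w s, base (slide w s))].
Proof.
pose e w := enum (fib (pi w)).
have ee w w' : pi w = pi w' -> e w = e w' by rewrite /e => ->.
have we w : w \in e w by rewrite mem_enum inE.
have eP w w' : w' \in e w -> pi w' = pi w by rewrite mem_enum inE => /eqP.
have eU w : uniq (e w) by apply: enum_uniq.
have sz w s : size (e (slide w s)) = size (e w).
  by rewrite -!cardE (card_fibre_slide w s).
have ix w s : (index w (e w) < size (e (slide w s)))%N by rewrite sz index_mem.
have e0 w : (0 < size (e w))%N by have := we w; case: (e w).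
pose th (x : W * S) := (out x.1 x.2,
  nth (slide x.1 x.2) (e (slide x.1 x.2)) (index x.1 (e x.1))).
pose base w := nth w (e w) 0.
have baseP w : pi (base w) = pi w by apply/eP/mem_nth/e0.
exists th, base; split.
- move=> [w s] [w' s'] [eo en].
  have es : pi (slide w s) = pi (slide w' s').
    rewrite -(eP _ _ (mem_nth (slide w s) (ix w s))) en.
    by apply/eP/mem_nth/ix.
  have [ew ->] := bwd es eo.
  move: en (ix w s) (ix w' s'); rewrite (ee _ _ es) => en i1 i2.
  move: en; rewrite (set_nth_default (slide w' s')) // => /eqP.
  rewrite nth_uniq // => /eqP ei; congr pair.
  by rewrite -(nth_index w (we w)) ei -(ee _ _ ew) nth_index // (ee _ _ ew).
- by move=> w s; split=> //=; apply/eP/mem_nth/ix.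
- move=> w s; have [eo es] := fwd s (baseP w).
  rewrite /th /=; congr pair => //.
  rewrite (ee _ _ es) (ee _ _ (baseP w)) /base index_uniq ?e0 ?eU //.
  by apply: set_nth_default; apply: e0.
Qed.
End FibreLift.

(** * Sliders from left-closing automata *)

Lemma window_eqP (S : finType) (n : nat) (x x' : config S) (i i' : int) :
  window n x i = window n x' i' <->
  forall k, (k < n)%N -> x (i + k%:Z) = x' (i' + k%:Z).
Proof.
split=> [e k kn|xx'].
  by rewrite -(nth_window x i (x 0) kn) e nth_window.
by apply: (@eq_window _ _ _ _ (x 0)) => k kn; rewrite nth_window // xx'.
Qed.

Ltac up_to_index H := by apply: etrans (etrans _ H) _; congr (_ _); lia.

Section OneSidedClosing.
Variables (S : finType) (s0 : S) (g : config S -> config S) (R L : nat).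
Hypothesis RL : (R <= L)%N.
Hypothesis gloc : forall (x x' : config S) (j j' : int),
  (forall k, (k <= R)%N -> x (j + k%:Z) = x' (j' + k%:Z)) -> g x j = g x' j'.
Hypothesis gcl : forall (x x' : config S) (j j' : int),
  (forall k, (k < L)%N -> x (j + 1 + k%:Z) = x' (j' + 1 + k%:Z)) ->
  (forall k, (k <= L)%N -> g x (j - k%:Z) = g x' (j' - k%:Z)) -> x j = x' j'.

Let stair (y : config S) (i : int) : L.-tuple S * L.-tuple S :=
  (window L (g y) i, window L y (i + L%:Z)).

Lemma stair_eqP (y y' : config S) (i i' : int) : stair y i = stair y' i' <->
  (forall k, (k < L)%N -> g y (i + k%:Z) = g y' (i' + k%:Z)) /\
  (forall k, (k < L)%N -> y (i + L%:Z + k%:Z) = y' (i' + L%:Z + k%:Z)).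
Proof.
split=> [e|[e1 e2]]; last by congr pair; apply/window_eqP.
by split; apply/window_eqP; [exact: (congr1 fst e) | exact: (congr1 snd e)].
Qed.

(** The only new entry of the output half is [g y (i + L)]; it depends on inputs up to [i + L + R],
    all known because [R <= L]. *)
Lemma stair_fwd (y y' : config S) (i i' : int) :
  stair y i = stair y' i' -> y (i + (L + L)%:Z) = y' (i' + (L + L)%:Z) ->
  g y i = g y' i' /\ stair y (i + 1) = stair y' (i' + 1).
Proof.
move=> /stair_eqP[eg ey] e.
have ey' k : (k <= L)%N -> y (i + L%:Z + k%:Z) = y' (i' + L%:Z + k%:Z).
  rewrite leq_eqVlt => /orP[/eqP ->|]; last exact: ey.
  by move: e; rewrite PoszD !addrA.
have eg' k : (k <= L)%N -> g y (i + k%:Z) = g y' (i' + k%:Z).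
  rewrite leq_eqVlt => /orP[/eqP ->|]; last exact: eg.
  by apply: gloc => m mR; apply: ey'; lia.
split; first by have := eg' 0%N isT; rewrite !addr0.
apply/stair_eqP; split=> k kL.
  up_to_index (eg' k.+1 kL).
up_to_index (ey' k.+1 kL).
Qed.

(** The input [y (i + L)] missing from the later stair is recovered by [gcl] from the next [L]
    inputs and the outputs on [[i, i + L]]. *)
Lemma stair_bwd (y y' : config S) (i i' : int) :
  stair y (i + 1) = stair y' (i' + 1) -> g y i = g y' i' ->
  stair y i = stair y' i' /\ y (i + (L + L)%:Z) = y' (i' + (L + L)%:Z).
Proof.
move=> /stair_eqP[eg ey] e.
have eg' k : (k <= L)%N -> g y (i + k%:Z) = g y' (i' + k%:Z).
  case: k => [_|k kL]; first by rewrite !addr0.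
  up_to_index (eg k kL).
have ey' k : (k <= L)%N -> y (i + L%:Z + k%:Z) = y' (i' + L%:Z + k%:Z).
  case: k => [_|k kL].
    rewrite !addr0; apply: gcl => k kL.
      up_to_index (ey k kL).
    up_to_index (eg' (L - k)%N (leq_subr _ _)).
  up_to_index (ey k kL).
split; last up_to_index (ey' L (leqnn _)).
by apply/stair_eqP; split=> k kL; [apply: eg' | apply: ey']; exact: ltnW.
Qed.

(** Outside the word the values are arbitrary (mirrored on the left, [s0] beyond the end); by [gloc]
    and [R <= L] they affect none of the functions below. *)
Let cfg (t : seq S) : config S := fun j => nth s0 t (absz j).
Let ext (w : (L + L).-tuple S) (s : S) : config S := cfg (rcons w s).
Let pi (w : (L + L).-tuple S) := stair (cfg w) 0.
Let slide (w : (L + L).-tuple S) (s : S) := window (L + L) (ext w s) 1.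
Let out (w : (L + L).-tuple S) (s : S) : S := g (ext w s) 0.
Let hd (w : (L + L).-tuple S) (s : S) : S := ext w s 0.

Lemma pi_window (y : config S) (i : int) : pi (window (L + L) y i) = stair y i.
Proof.
have cE (k : nat) : (k < L + L)%N -> cfg (window (L + L) y i) k%:Z = y (i + k%:Z).
  by move=> kL; rewrite /cfg nth_window.
apply/stair_eqP; split=> k kL.
  apply: gloc => m mR; rewrite add0r -PoszD cE; last by lia.
  by congr (y _); lia.
by rewrite add0r -PoszD cE; [congr (y _); lia | lia].
Qed.

Lemma window_ext w s : window (L + L).+1 (ext w s) 0 = [tuple of rcons w s].
Proof. by apply: (@eq_window _ _ _ _ s0) => k kL; rewrite add0r. Qed.

Lemma ext_last w s : ext w s (L + L)%:Z = s.
Proof. by rewrite /ext /cfg nth_rcons size_tuple ltnn eqxx. Qed.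

Lemma window_ext0 w s : window (L + L) (ext w s) 0 = w.
Proof. by have := window_ext w s; rewrite window_rcons => /rcons_tuple_inj[]. Qed.

Lemma pi_ext w s : pi w = stair (ext w s) 0.
Proof. by rewrite -pi_window window_ext0. Qed.

Lemma pi_slide w s : pi (slide w s) = stair (ext w s) 1.
Proof. exact: pi_window. Qed.

Lemma slide_inj w s w' s' :
  hd w s = hd w' s' -> slide w s = slide w' s' -> w = w' /\ s = s'.
Proof.
move=> eh es; have : [tuple of rcons w s] = [tuple of rcons w' s'].
  by rewrite -!window_ext !window_cons add0r; congr [tuple of _ :: _]; rewrite // -/(slide _ _) es.
by move=> /rcons_tuple_inj[-> ->].
Qed.

Lemma pi_fwd w w' s : pi w = pi w' ->
  out w s = out w' s /\ pi (slide w s) = pi (slide w' s).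
Proof.
rewrite (pi_ext w s) (pi_ext w' s) !pi_slide => /stair_fwd.
by rewrite !add0r !ext_last => /(_ erefl).
Qed.

Lemma pi_bwd w w' s s' : pi (slide w s) = pi (slide w' s') ->
  out w s = out w' s' -> pi w = pi w' /\ s = s'.
Proof.
rewrite (pi_ext w s) (pi_ext w' s') !pi_slide.
have := @stair_bwd (ext w s) (ext w' s') 0 0.
by rewrite !add0r !ext_last.
Qed.

(* In a run of the lifted transducer the windows of the successive states
   overlap, so the input and the output are read off from them. *)
Lemma run_output (q : int -> (L + L).-tuple S) (y z : config S) :
  (forall i, z i = out (q i) (y (i + (L + L)%:Z)) /\
     pi (q (i + 1)) = pi (slide (q i) (y (i + (L + L)%:Z)))) ->
  g y = z.
Proof.
move=> qP; pose x i := ext (q i) (y (i + (L + L)%:Z)).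
have xS i : stair (x i) 1 = stair (x (i + 1)) 0.
  by rewrite -pi_slide -pi_ext; have [_ ->] := qP i.
(* The last symbol of [x i] is the input just read; by [xS] the other symbols of its right half are
   inherited from [x (i - 1)]. The induction is on [d = L - k]. *)
have xy d k i : (k + d = L)%N -> x i (L + k)%:Z = y (i + (L + k)%:Z).
  elim: d k i => [|d IH] k i kd.
    by rewrite -(addn0 k) kd /x ext_last.
  have /stair_eqP[_ /(_ k)] := xS (i - 1).
  rewrite subrK add0r => /(_ _) e; rewrite PoszD -e; last by lia.
  have kd' : (k.+1 + d = L)%N by lia.
  up_to_index (IH k.+1 (i - 1) kd').
(* At [k = L] the output is computed from the true inputs found in [xy]; smaller [k] are again
   inherited through [xS]. *)
have gx d k i : (k + d = L)%N -> g (x i) k%:Z = g y (i + k%:Z).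
  elim: d k i => [|d IH] k i kd.
    have -> : k = L by lia.
    apply: gloc => m mR; have := @xy (L - m)%N m i _.
    rewrite PoszD addrA; apply; lia.
  have /stair_eqP[/(_ k) + _] := xS (i - 1).
  rewrite subrK add0r => e; rewrite -e; last by lia.
  have kd' : (k.+1 + d = L)%N by lia.
  up_to_index (IH k.+1 (i - 1) kd').
apply/funext => i; have [-> _] := qP i.
by have := gx L 0%N i erefl; rewrite addr0 => <-.
Qed.

Lemma one_sided_closing_slider : lr_slider g.
Proof.
have [th [base [thI thP thB]]] := fibre_lift slide_inj pi_fwd pi_bwd.
pose rc (x : (L + L).-tuple S * S) : (L + L).+1.-tuple S :=
  [tuple of rcons x.1 x.2].
have [dec rcK decK] : bijective rc.
  apply: inj_card_bij => [[w s] [w' s'] /rcons_tuple_inj //|].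
  by rewrite card_prod !card_tuple expnSr.
pose chi (t : (L + L).+1.-tuple S) : (L + L).+1.-tuple S :=
  [tuple of (th (dec t)).1 :: (th (dec t)).2].
have chiI : injective chi.
  move=> t t' e; apply: (can_inj decK); apply: thI.
  move: e => /(congr1 val) [e1 e2].
  by rewrite (surjective_pairing (th _)) e1 (val_inj e2) -surjective_pairing.
have chiE (q q' : (L + L).-tuple S) (s a : S) : chi [tuple of rcons q s] = [tuple of a :: q'] <->
    th (q, s) = (a, q').
  have -> : [tuple of rcons q s] = rc (q, s) by [].
  rewrite /chi rcK.
  split=> [/(congr1 val) [<- e]|->]; last by apply: val_inj.
  by rewrite -(val_inj e) -surjective_pairing.
have [xi chiK xiK] := injF_bij chiI.
exists (L + L).+1, chi, xi; split=> // y z.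
rewrite slider_relation_run //; split=> [[q qP]|<-].
  apply: (@run_output q) => i; have /chiE e := qP i.
  by have := thP (q i) (y (i + (L + L)%:Z)); rewrite e.
(* Conversely, the rank 0 words over the successive windows of [y] form a run, by [thB]. *)
exists (fun i => base (window (L + L) y i)) => i; apply/chiE; rewrite thB.
have wE : window (L + L).+1 (ext (window (L + L) y i) (y (i + (L + L)%:Z))) 0 =
    window (L + L).+1 y i by rewrite window_ext window_rcons.
congr pair.
  apply: gloc => k kR; have /window_eqP := wE; apply; lia.
congr base; have := wE; rewrite !window_cons add0r => /(congr1 val)[_ e].
by apply: val_inj; exact: e.
Qed.

End OneSidedClosing.

Lemma left_closing_CA_slider (S : finType) (s0 : S) (f : config S -> config S) :
  left_closing_CA f ->
  exists N, forall c, (N <= c)%N -> lr_slider (translate c%:Z \o f).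
Proof.
move=> [fCA fcl]; have [r floc] := CA_local fCA.
(* Shifting by [c >= r] moves the neighbourhood [[-r, r]] into [[0, 2c]], so [g] looks only to the
   right. *)
exists r => c rc; set g := _ \o f.
have gloc (x x' : config S) (j j' : int) :
    (forall k, (k <= c + c)%N -> x (j + k%:Z) = x' (j' + k%:Z)) ->
    g x j = g x' j'.
  move=> xx'; rewrite /g /= /translate.
  have E (z : config S) i : f z i = f (translate i z) 0.
    by rewrite (commute_translate fCA.2) /translate add0r.
  rewrite [LHS]E [RHS]E; apply: floc => i ir; rewrite /translate.
  have := xx' (absz (i + c%:Z)%R); move=> /(_ _) h.
  by apply: etrans (etrans _ (h _)) _; [congr (_ _); lia | lia | congr (_ _); lia].
(* A uniform form of left-closing, by compactness: otherwise counterexamples accumulate at two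
   points that agree from 1 on, differ at 0 and have the same image. *)
have [L0 gcl] : exists L0, forall x x' : config S,
    (forall k, (k < L0)%N -> x (1 + k%:Z) = x' (1 + k%:Z)) ->
    (forall k, (k <= L0)%N -> g x (- k%:Z) = g x' (- k%:Z)) -> x 0 = x' 0.
  apply: contrapT => /forallNP nL.
  have /choice[p pP] : forall n, exists p : config S * config S,
      [/\ forall k, (k < n)%N -> p.1 (1 + k%:Z) = p.2 (1 + k%:Z),
          forall k, (k <= n)%N -> g p.1 (- k%:Z) = g p.2 (- k%:Z) &
          p.1 0 <> p.2 0].
    move=> n; have /existsNP[x /existsNP[x']] := nL n.
    by move=> /not_implyP[h1 /not_implyP[h2 h3]]; exists (x, x').
  pose u n : config (S * S)%type := fun i => ((p n).1 i : S, (p n).2 i : S).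
  have [a au] := config_seq_cluster u.
  pose x : config S := fun i => (a i).1; pose x' : config S := fun i => (a i).2.
  have xu n (m : nat) j : agree n a (u m) -> (absz j <= n)%N ->
      x j = (p m).1 j /\ x' j = (p m).2 j.
    by move=> aum jn; rewrite /x /x' aum.
  have xx' j : 1 <= j -> x j = x' j.
    move=> j1; have [m jm aum] := au (absz j) (absz j).
    have [-> ->] := xu _ _ j aum (leqnn _); have [h _ _] := pP m.
    have := h (absz (j - 1)%R) _.
    have -> : 1 + (absz (j - 1)%R)%:Z = j by lia.
    by apply; lia.
  apply: (fcl x x') => [xE||].
  - have [m _ aum] := au 0%N 0%N; have [_ _] := pP m; apply.
    by have [<- <-] := xu _ _ 0 aum (leqnn _); rewrite xE.
  - by exists 1.
  suff gE : g x = g x'.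
    apply/funext => j; have := congr1 (fun z : config S => z (j - c%:Z)) gE.
    by rewrite /g /= /translate subrK.
  (* From 1 on, [g] sees only common symbols; at [j <= 0] both images are those of a close pair
     [p m], which agree there. *)
  apply/funext => j; have [j1|j1] := leP 1 j.
    by apply: gloc => k _; apply: xx'; lia.
  have [m jm aum] := au (absz j + (c + c))%N (absz j).
  have xg : g x j = g (p m).1 j.
    by apply: gloc => k kc; have [] := xu _ _ (j + k%:Z) aum _; first lia.
  have xg' : g x' j = g (p m).2 j.
    by apply: gloc => k kc; have [] := xu _ _ (j + k%:Z) aum _; first lia.
  have [_ h _] := pP m; have := h _ jm.
  have -> : - (absz j)%:Z = j by lia.
  by rewrite xg xg'.
apply: (@one_sided_closing_slider S s0 g (c + c) (maxn L0 (c + c))) => //.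
  exact: leq_maxr.
move=> x x' j j' xx' gg'.
have tr (z : config S) i k : g (translate i z) k = g z (i + k).
  by apply: gloc => m _; rewrite /translate; congr (z _); lia.
have := gcl (translate j x) (translate j' x').
rewrite /translate !add0r; apply=> k kL.
  have kL' : (k < maxn L0 (c + c))%N by lia.
  up_to_index (xx' k kL').
by rewrite [LHS]tr [RHS]tr; apply: gg'; lia.
Qed.

(** * Mirror images *)

Section Flip.
Variable S : finType.
Implicit Types (x : config S) (f : config S -> config S).

Lemma flipK x : flip (flip x) = x.
Proof. by apply/funext => j; rewrite /flip opprK. Qed.

Lemma flip_translate c x : flip (translate c x) = translate (- c) (flip x).
Proof. by apply/funext => j; rewrite /flip /translate opprD opprK. Qed.

Lemma flip_conjK f : @flip S \o (@flip S \o f \o @flip S) \o @flip S = f.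
Proof. by apply/funext => x /=; rewrite !flipK. Qed.

Lemma flip_CA f :
  cellular_automaton f -> cellular_automaton (@flip S \o f \o @flip S).
Proof.
move=> fCA; have fT := commute_translate fCA.2.
have sT x : shift x = translate 1 x by [].
apply: CA_of_local => [x|y] /=.
  by rewrite !sT flip_translate fT flip_translate opprK.
have [r floc] := CA_local fCA; exists r => x yx.
rewrite /flip oppr0; apply: floc => j jr.
by rewrite yx //; lia.
Qed.

Lemma flip_right_closing f :
  right_closing_CA f -> left_closing_CA (@flip S \o f \o @flip S).
Proof.
move=> [fCA fcl]; split; first exact: flip_CA.
move=> y y' yn [i yy'] /(congr1 (@flip S)) /=; rewrite !flipK.
apply: fcl => [e|]; first by apply: yn; rewrite -(flipK y) e flipK.
(* The reflection maps the positions [j < 1 - i] onto those that are at least [i]. *)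
by exists (1 - i) => j ji; apply: yy'; lia.
Qed.

Lemma flip_left_closing f :
  left_closing_CA f -> right_closing_CA (@flip S \o f \o @flip S).
Proof.
move=> [fCA fcl]; split; first exact: flip_CA.
move=> y y' yn [i yy'] /(congr1 (@flip S)) /=; rewrite !flipK.
apply: fcl => [e|]; first by apply: yn; rewrite -(flipK y) e flipK.
by exists (1 - i) => j ji; apply: yy'; lia.
Qed.

Lemma rl_slider_right_closing f : rl_slider f -> right_closing_CA f.
Proof.
by move=> /slider_left_closing /flip_left_closing; rewrite flip_conjK.
Qed.

Lemma right_closing_CA_slider (s0 : S) f : right_closing_CA f ->
  exists N, forall c, (N <= c)%N -> rl_slider (translate (- c%:Z) \o f).
Proof.
move=> /flip_right_closing /(left_closing_CA_slider s0)[N sl].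
exists N => c /sl; rewrite /rl_slider /=; congr lr_slider.
by apply/funext => x /=; rewrite flip_translate opprK.
Qed.

End Flip.

(** * Alternating compositions *)

Section Alternating.
Variable T : Type.

Lemma alternating_sub (X X' Y Y' : set (T -> T)) (k : nat) :
  X `<=` X' -> Y `<=` Y' -> alternating X Y k `<=` alternating X' Y' k.
Proof.
elim: k X X' Y Y' => [|k IH] X X' Y Y' XX' YY' h; first by [].
move=> [f Xf [g Yg <-]].
by exists f; [exact: XX' | exists g => //; exact: IH Yg].
Qed.

Definition eventually_in (s : int -> T -> T) (A B : set (T -> T)) : Prop :=
  forall f, A f -> exists N, forall c, (N <= c)%N -> B (s c%:Z \o f).

Variable s : int -> T -> T.
Hypothesis sD : forall a b x, s a (s b x) = s (a + b) x.

(** The outer factor absorbs a large shift in one direction and the inner factor nearly the opposite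
    one, leaving any prescribed net shift [c]. *)
Lemma comp_any_shift (X' X A B : set (T -> T)) :
  (forall f, X' f -> forall c x, f (s c x) = s c (f x)) ->
  eventually_in (fun c => s (- c)) X' X -> eventually_in s A B ->
  forall f g, X' f -> A g -> forall c,
  exists2 f', X f' & exists2 g', B g' & f' \o g' = s c \o (f \o g).
Proof.
move=> sX XX AB f g Xf Ag c; have [N fN] := XX f Xf; have [M gM] := AB g Ag.
(* This makes [a >= N] and [a + c >= M]. *)
pose a := (N + M + absz c)%N.
exists (s (- a%:Z) \o f); first by apply: fN; lia.
exists (s (absz (a%:Z + c)%R)%:Z \o g); first by apply: gM; lia.
by apply/funext => x /=; rewrite sX // sD; congr (s _ _); lia.
Qed.

End Alternating.

Lemma alternating_eventually (T : Type) (s : int -> T -> T)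
    (X' X Y' Y : set (T -> T)) :
  (forall a b x, s a (s b x) = s (a + b) x) -> (forall x, s 0 x = x) ->
  (forall f, X' f -> forall c x, f (s c x) = s c (f x)) ->
  (forall f, Y' f -> forall c x, f (s c x) = s c (f x)) ->
  eventually_in (fun c => s (- c)) X' X -> eventually_in s Y' Y ->
  forall k,
    [/\ eventually_in (fun c => s (- c)) (alternating X' Y' k.+1)
          (alternating X Y k.+1),
        eventually_in s (alternating Y' X' k.+1) (alternating Y X k.+1),
        alternating X' Y' k.+2 `<=` alternating X Y k.+2 &
        alternating Y' X' k.+2 `<=` alternating Y X k.+2].
Proof.
move=> sD s0 sX sY XX YY.
(* Reversing the shift exchanges the roles of [X] and [Y], so [comp_any_shift] also covers products
   starting with [Y']. *)
pose s' c := s (- c).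
have sD' a b x : s' a (s' b x) = s' (a + b) x by rewrite /s' sD opprD.
have YY' : eventually_in (fun c => s' (- c)) Y' Y.
  move=> f /YY[N fN]; exists N => c /fN.
  by congr Y; apply/funext => x /=; rewrite /s' opprK.
have sY' f : Y' f -> forall c x, f (s' c x) = s' c (f x).
  by move=> Yf c x; apply: sY.
(* One more factor turns large shifts in one direction into arbitrary shifts; [c = 0] then gives the
   inclusions. *)
have full k : eventually_in s' (alternating X' Y' k) (alternating X Y k) ->
    eventually_in s (alternating Y' X' k) (alternating Y X k) ->
    (forall f c, alternating X' Y' k.+1 f -> alternating X Y k.+1 (s c \o f)) /\
    (forall f c, alternating Y' X' k.+1 f -> alternating Y X k.+1 (s c \o f)).
  move=> evX evY; split=> _ c [f Xf [g Yg <-]].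
    have [f' Xf' [g' Yg' e]] := comp_any_shift sD sX XX evY Xf Yg c.
    by rewrite -e; exists f' => //; exists g'.
  have [f' Xf' [g' Yg' e]] := comp_any_shift sD' sY' YY' evX Xf Yg (- c).
  rewrite /s' opprK in e.
  by rewrite -e; exists f' => //; exists g'.
have sub0 (A B : set (T -> T)) : (forall f c, A f -> B (s c \o f)) -> A `<=` B.
  move=> AB f /(AB f 0); congr B; apply/funext => x /=; exact: s0.
have ev k : eventually_in s' (alternating X' Y' k.+1) (alternating X Y k.+1) /\
    eventually_in s (alternating Y' X' k.+1) (alternating Y X k.+1).
  elim: k => [|k [evX evY]].
    split=> _ [f Xf [_ -> <-]].
      have [N fN] := XX f Xf; exists N => c Nc.
      by exists (s' c%:Z \o f); [exact: fN | exists id].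
    have [N fN] := YY f Xf; exists N => c Nc.
    by exists (s c%:Z \o f); [exact: fN | exists id].
  have [fX fY] := full _ evX evY.
  by split=> f fP; exists 0%N => c _; [exact: fX | exact: fY].
move=> k; have [evX evY] := ev k; have [fX fY] := full _ evX evY.
by split=> //; apply: sub0.
Qed.

Theorem theorem35 (S : finType) (hS : (0 < #|S|)%N) (k : nat) (hk : (2 <= k)%N) :
  L_ S k = Rcl_ S k /\ R_ S k = Lcl_ S k.
Proof.
case: k hk => [//|[//|k]] _.
have [s0 _] : exists s0 : S, s0 \in S by apply/existsP; rewrite -lt0n.
have comm (f : config S -> config S) : cellular_automaton f ->
    forall c x, f (translate c x) = translate c (f x).
  by move=> [_ fs]; exact: commute_translate.
have [_ _ LR RL] := @alternating_eventually (config S) (@translate S)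
  (@right_closing_CA S) (@rl_slider S) (@left_closing_CA S) (@lr_slider S)
  (@translateD S) (@translate0 S)
  (fun f fP => comm f fP.1) (fun f fP => comm f fP.1)
  (right_closing_CA_slider s0) (left_closing_CA_slider s0) k.
(* Sliders are closing factor by factor; the reverse inclusions are [LR] and [RL]. *)
by split; apply/seteqP; split=> //; apply: alternating_sub;
  first [exact: rl_slider_right_closing | exact: slider_left_closing].
Qed.
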